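(* Let $K$ be a perfect field, $V_1,\dots,V_d$ finite-dimensional $K$-vector spaces, $V=V_1\otimes\cdots\otimes V_d$, $v\in V$ and $\alpha\in\mathbb{R}_{>0}^d$. Then the $G$-stable $\alpha$-rank $\operatorname{rk}^G_\alpha(v)$ is equal to the infimum of $\mu_\alpha(\lambda(t),v)$ over all $1$-parameter subgroups $\lambda(t)\in G(K[t])$ of $G=\mathrm{GL}(V_1)\times\cdots\times\mathrm{GL}(V_d)$ with $\operatorname{val}_t(\lambda(t)\cdot v)>0$.
   Context: For a $K$-vector space $W$ and $v(t)\in K((t))\otimes W$, $\operatorname{val}_t(v(t))$ is the largest integer $m$ with $v(t)\in t^m(K[[t]]\otimes W)$, and $\operatorname{val}_t(0)=\infty$. For a $K$-subalgebra $R\subseteq K((t))$, $\mathrm{GL}(V_i,R)$ is the set of elements of $R\otimes\operatorname{End}(V_i)$ that are invertible over $K((t))$ (the inverse need not have entries in $R$), and $G(R)=\mathrm{GL}(V_1,R)\times\cdots\times\mathrm{GL}(V_d,R)$, acting on $K((t))\otimes V$ factorwise. For $g(t)=(g_1(t),\dots,g_d(t))\in G(K[[t]])$ with $\operatorname{val}_t(g(t)\cdot v)>0$, $$\mu_\alpha(g(t),v)=\frac{\sum_{i=1}^d\alpha_i\operatorname{val}_t(\det g_i(t))}{\operatorname{val}_t(g(t)\cdot v)}$$ (a quotient with denominator $\infty$ is $0$). The $G$-stable $\alpha$-rank $\operatorname{rk}^G_\alpha(v)$ is the infimum of $\mu_\alpha(g(t),v)$ over all $g(t)\in G(K[[t]])$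 with $\operatorname{val}_t(g(t)\cdot v)>0$. An element $\lambda(t)=(\lambda_1(t),\dots,\lambda_d(t))\in G(K[t])$ is a $1$-parameter subgroup if for every $i$ there is a $K$-basis of $V_i$ with respect to which the matrix of $\lambda_i(t)$ is diagonal with each diagonal entry of the form $t^{x}$, $x$ a nonnegative integer. *)

(* Defs.v *)
From HB Require Import structures.
From mathcomp Require Import all_boot all_order all_algebra all_field.
From mathcomp Require Import generic_quotient boolp classical_sets reals ereal constructive_ereal.

Set Implicit Arguments.
Unset Strict Implicit.
Unset Printing Implicit Defensive.
Import Order.TTheory GRing.Theory Num.Theory.
Local Open Scope classical_set_scope.
Local Open Scope ring_scope.

Definition perfect_field (K : fieldType) : Prop :=
  forall p : {poly K}, irreducible_poly p -> separable_poly p.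

(** * The ring K[[t]] and the field K((t)) *)

(* A record, so that the Cauchy product below does not clash with the pointwise
   ring structure on [nat -> K]. *)
Record pseries (K : fieldType) := PSeries { ps_coef : nat -> K }.

Section PowerSeries.
Variable K : fieldType.
Implicit Types p q r : pseries K.

HB.instance Definition _ := [isNew for @ps_coef K].
HB.instance Definition _ := [Choice of pseries K by <:].

Lemma psP p q : (forall n, ps_coef p n = ps_coef q n) <-> p = q.
Proof.
split=> [|->//]; case: p q => [p] [q] /= pq.
by congr PSeries; apply/funext.
Qed.

Definition ps0 : pseries K := PSeries (fun=> 0).
Definition ps_opp p := PSeries (fun n => - ps_coef p n).
Definition ps_add p q := PSeries (fun n => ps_coef p n + ps_coef q n).
Definition ps_of_poly (P : {poly K}) : pseries K := PSeries (fun n => P`_n).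
Definition ps1 : pseries K := ps_of_poly 1.
Definition ps_mul p q :=
  PSeries (fun n => \sum_(i < n.+1) ps_coef p i * ps_coef q (n - i)).

Fact ps_addA : associative ps_add.
Proof. by move=> p q r; apply/psP => n /=; rewrite addrA. Qed.
Fact ps_addC : commutative ps_add.
Proof. by move=> p q; apply/psP => n /=; rewrite addrC. Qed.
Fact ps_add0 : left_id ps0 ps_add.
Proof. by move=> p; apply/psP => n /=; rewrite add0r. Qed.
Fact ps_addN : left_inverse ps0 ps_opp ps_add.
Proof. by move=> p; apply/psP => n /=; rewrite addNr. Qed.

HB.instance Definition _ :=
  GRing.isZmodule.Build (pseries K) ps_addA ps_addC ps_add0 ps_addN.

Let trunc N p : {poly K} := \poly_(i < N.+1) ps_coef p i.

Let coef_trunc N p n : (n <= N)%N -> (trunc N p)`_n = ps_coef p n.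
Proof. by move=> nN; rewrite coef_poly ltnS nN. Qed.

Let coef_mul N p q n : (n <= N)%N ->
  ps_coef (ps_mul p q) n = (trunc N p * trunc N q)`_n.
Proof.
move=> nN; rewrite coefM /=; apply: eq_bigr => i _.
rewrite !coef_trunc //; first exact: leq_trans (leq_subr _ _) nN.
by apply: leq_trans nN; rewrite -ltnS.
Qed.

Fact ps_mulC : commutative ps_mul.
Proof. by move=> p q; apply/psP => n; rewrite !(@coef_mul n) // mulrC. Qed.

Fact ps_mulA : associative ps_mul.
Proof.
move=> p q r; apply/psP => n.
have lt_n (i : 'I_n.+1) : (i <= n)%N by rewrite -ltnS.
transitivity ((trunc n p * (trunc n q * trunc n r))`_n).
  rewrite coefM; apply: eq_bigr => i _.
  by rewrite coef_trunc // -coef_mul ?leq_subr.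
rewrite mulrA coefM; apply: eq_bigr => i _.
by rewrite coef_trunc ?leq_subr // -coef_mul.
Qed.

Fact ps_mul1 : left_id ps1 ps_mul.
Proof.
move=> p; apply/psP => n /=; rewrite big_ord_recl /= coef1 eqxx mul1r subn0.
by rewrite big1 ?addr0 // => i _; rewrite coef1 mul0r.
Qed.

Fact ps_mulDl : left_distributive ps_mul +%R.
Proof.
move=> p q r; apply/psP => n /=; rewrite -big_split /=.
by apply: eq_bigr => i _; rewrite mulrDl.
Qed.

Fact ps1_neq0 : ps1 != 0 :> pseries K.
Proof.
apply/eqP => /psP /(_ 0%N) /=; rewrite coef1 eqxx => /eqP.
by rewrite oner_eq0.
Qed.

HB.instance Definition _ := GRing.Zmodule_isComNzRing.Build (pseries K)
  ps_mulA ps_mulC ps_mul1 ps_mulDl ps1_neq0.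

Definition ps_unit : {pred pseries K} := fun p => `[< exists q, q * p = 1 >].
Definition ps_inv p : pseries K :=
  if pselect (exists q, q * p = 1) is left e then sval (cid e) else p.

Fact ps_mulV : {in ps_unit, left_inverse 1 ps_inv *%R}.
Proof.
move=> p /asboolP pU; rewrite /ps_inv; case: pselect => // e.
exact: svalP (cid e).
Qed.
Fact ps_unitP p q : q * p = 1 -> ps_unit p.
Proof. by move=> qp; apply/asboolP; exists q. Qed.
Fact ps_inv_out : {in [predC ps_unit], ps_inv =1 id}.
Proof.
move=> p /negP pU; rewrite /ps_inv; case: pselect => // e.
by case: pU; apply/asboolP.
Qed.

HB.instance Definition _ := GRing.ComNzRing_hasMulInverse.Build (pseries K)
  ps_mulV ps_unitP ps_inv_out.

Fact ps_integral : GRing.integral_domain_axiom (pseries K).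
Proof.
have low p : p != 0 -> exists2 n, ps_coef p n != 0 &
    forall i, (i < n)%N -> ps_coef p i = 0.
  move=> p0; have ex : exists n, ps_coef p n != 0.
    apply/not_existsP => h; move/eqP: p0; apply; apply/psP => n.
    by apply/eqP/negPn/negP/h.
  exists (ex_minn ex) => [|i]; first by case: ex_minnP.
  case: ex_minnP => m _ mP im; apply/eqP/negPn/negP => /mP.
  by rewrite leqNgt im.
move=> p q pq; apply/norP => -[/low[m pm mP] /low[n qn nP]].
move/psP: pq => /(_ (m + n)%N)/eqP; apply/negP => /=.
have mlt : (m < (m + n).+1)%N by rewrite ltnS leq_addr.
rewrite (bigD1 (Ordinal mlt)) //= addKn big1 ?addr0 ?mulf_neq0 // => i im.
have [lt|gt|e] := ltngtP i m; first by rewrite mP ?mul0r.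
  rewrite [X in _ * X]nP ?mulr0 // ltn_subLR; last by rewrite -ltnS.
  by rewrite ltn_add2r.
by case/eqP: im; apply/val_inj.
Qed.

HB.instance Definition _ :=
  GRing.ComUnitRing_isIntegral.Build (pseries K) ps_integral.

End PowerSeries.

Definition laurent (K : fieldType) : fieldType := {fraction pseries K}.

Section Laurent.
Variable K : fieldType.

Definition ps_laurent : pseries K -> laurent K := @FracField.tofrac (pseries K).
Definition laurent_const (c : K) : laurent K := ps_laurent (ps_of_poly c%:P).
Definition laurent_t : laurent K := ps_laurent (ps_of_poly 'X).

(* K[[t]] and K[t] as subsets of K((t)). *)
Definition Ktt : set (laurent K) := range ps_laurent.
Definition Kt : set (laurent K) := range (ps_laurent \o @ps_of_poly K).

(* If W has a basis indexed by I, then K((t)) (x) W is I -> K((t)); multiplying by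
   t^m the elements with coordinates in K[[t]] gives t^m (K[[t]] (x) W). *)
Definition tpow_lattice (I : finType) (m : int) : set (I -> laurent K) :=
  [set w | forall i, exists2 u, Ktt u & w i = laurent_t ^ m * u].

(* [xget] selects the largest m; it exists and is unique when w != 0, see
   [val_t_largest]. *)
Definition val_t (R : realType) (I : finType) (w : I -> laurent K) : \bar R :=
  if `[< forall i, w i = 0 >] then +oo%E
  else ((xget 0 [set m : int | tpow_lattice m w /\
                   forall m', tpow_lattice m' w -> m' <= m])%:~R)%:E.

Definition val_t1 (R : realType) (x : laurent K) : \bar R :=
  val_t R (fun _ : unit => x).

Lemma ps_coefXM (p : pseries K) n :
  ps_coef (ps_of_poly 'X * p) n = if n is n'.+1 then ps_coef p n' else 0.
Proof.
rewrite [LHS]big_ord_recl /= coefX mul0r add0r.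
case: n => [|n]; first by rewrite big_ord0.
rewrite big_ord_recl /= coefX mul1r subSS subn0 big1 ?addr0 // => i _.
by rewrite coefX mul0r.
Qed.

Let inv_seq (p : pseries K) := fix s n : seq K := if n is n'.+1 then
  rcons (s n') (- (\sum_(i < n') ps_coef p i.+1 * (s n')`_(n' - i.+1)) / ps_coef p 0
                + (n' == 0%N)%:R / ps_coef p 0) else [::].

Lemma ps_unitE (p : pseries K) : ps_coef p 0 != 0 -> p \is a GRing.unit.
Proof.
move=> p0; set s := inv_seq p.
have size_s n : size (s n) = n by elim: n => //= n IH; rewrite size_rcons IH.
have nth_s n m : (n < m)%N -> (s m)`_n = (s n.+1)`_n.
  elim: m => // m IH; rewrite ltnS leq_eqVlt => /predU1P[->//|nm].
  by rewrite [s m.+1]/= nth_rcons size_s nm IH.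
pose q := PSeries (fun n => (s n.+1)`_n).
suff e : q * p = 1 by apply/unitrPr; exists q; rewrite mulrC.
rewrite mulrC; apply/psP => n; rewrite [LHS]big_ord_recl /= subn0 coef1.
rewrite nth_rcons size_s ltnn eqxx -mulrDl mulrC divfK // addrAC.
rewrite [X in X + _](_ : _ = 0) ?add0r //.
apply/eqP; rewrite addrC subr_eq0; apply/eqP.
apply: eq_bigr => i _; congr (_ * _); rewrite /bump /= add1n.
by rewrite [RHS]nth_s //; case: n i => [[]//|n i]; rewrite subSS ltnS leq_subr.
Qed.

Lemma laurent_t_neq0 : laurent_t != 0.
Proof.
rewrite tofrac_eq0; apply/eqP => /psP /(_ 1%N) /=; rewrite coefX => /eqP.
by rewrite oner_eq0.
Qed.

(* Every nonzero Laurent series is t^k times a unit of K[[t]]. *)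
Lemma laurent_normal (a : laurent K) : a != 0 ->
  exists k : int, exists2 u, ps_coef u 0 != 0 & a = laurent_t ^ k * ps_laurent u.
Proof.
have t0 := laurent_t_neq0.
have dec p : p != 0 -> exists k : nat, exists2 u, ps_coef u 0 != 0 &
    ps_laurent p = laurent_t ^+ k * ps_laurent u.
  move=> p0; have [n pn] : exists n, ps_coef p n != 0.
    apply/not_existsP => h; move/eqP: p0; apply; apply/psP => n.
    by apply/eqP/negPn/negP/h.
  elim: n p {p0} pn => [|n IH] p pn; first by exists 0%N, p; rewrite ?mul1r.
  have [p0|p0] := eqVneq (ps_coef p 0) 0; last by exists 0%N, p; rewrite ?mul1r.
  have [k [u u0 e]] := IH (PSeries (fun n => ps_coef p n.+1)) pn.
  exists k.+1, u => //; rewrite exprS -mulrA -e -[RHS]tofracM; congr ps_laurent.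
  by apply/psP => -[|m]; rewrite ps_coefXM.
have [n [m m0 ->]] : exists n, exists2 m, m != 0 &
    a = ps_laurent n / ps_laurent m.
  elim/quotW: a => x; exists \n_x, \d_x; rewrite ?denom_ratioP //.
  apply: (canRL (mulfK _)); first by rewrite tofrac_eq0 denom_ratioP.
  rewrite /ps_laurent; unlock FracField.tofrac; rewrite -[LHS]FracField.pi_mul.
  apply/eqmodP; rewrite /= FracField.equivfE /FracField.mulf.
  by rewrite !numden_Ratio ?mulr1 ?oner_eq0 ?denom_ratioP // mulrC.
rewrite mulf_eq0 invr_eq0 !tofrac_eq0 (negPf m0) orbF => n0.
have [k [u u0 ->]] := dec _ n0; have [l [w w0 ->]] := dec _ m0.
have wU := ps_unitE w0.
exists (k%:Z - l%:Z), (u * w^-1).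
  have := congr1 (@ps_coef K ^~ 0%N) (mulVr wU) => /=.
  rewrite big_ord1 subnn coef1 eqxx => e; rewrite big_ord1 mulf_neq0 //.
  by apply: contra_eq_neq e => ->; rewrite mul0r eq_sym oner_eq0.
rewrite expfzDr // -invr_expz -!exprnP invfM mulrACA; congr (_ * _).
by rewrite /ps_laurent tofracM (rmorphV _ wU).
Qed.

Lemma val_t_largest (R : realType) (I : finType) (w : I -> laurent K) :
  (exists i, w i != 0) ->
  exists m : int, [/\ tpow_lattice m w,
    forall m', tpow_lattice m' w -> m' <= m & val_t R w = (m%:~R)%:E].
Proof.
move=> [i0 wi0].
have /choice[k kP] : forall i, exists k : int, w i != 0 ->
    exists2 u, ps_coef u 0 != 0 & w i = laurent_t ^ k * ps_laurent u.
  move=> i; have [->|/laurent_normal[k kP]] := eqVneq (w i) 0; first by exists 0.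
  by exists k.
have t0 := laurent_t_neq0.
have bound i m' : w i != 0 -> tpow_lattice m' w -> m' <= k i.
  move=> wi /(_ i)[_ [p _ <-]]; have [u u0 ->] := kP _ wi.
  rewrite leNgt => e; apply/negP => lt; move/eqP: u0; apply.
  have [n En] : exists n : nat, m' = k i + n.+1.
    exists `|m' - k i|%N.-1; rewrite prednK ?absz_gt0 ?subr_eq0 ?gt_eqF //.
    by rewrite gtz0_abs ?subr_gt0 // subrKC.
  move: e; rewrite En expfzDr // -mulrA => /(mulfI (expfz_neq0 _ t0)).
  rewrite -exprnP /laurent_t /ps_laurent -tofracXn -tofracM => /eqP.
  by rewrite tofrac_eq => /eqP->; rewrite exprS -mulrA ps_coefXM.
pose i1 := [arg min_(i < i0 | w i != 0) k i]%O.
have [wi1 min1] : w i1 != 0 /\ forall j, w j != 0 -> k i1 <= k j.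
  by rewrite /i1; case: arg_minP.
have lat : tpow_lattice (k i1) w.
  move=> j; have [->|wj] := eqVneq (w j) 0.
    by exists 0; [exists 0; rewrite // /ps_laurent tofrac0 | rewrite mulr0].
  have [u _ ->] := kP _ wj; have := min1 _ wj; rewrite -subr_ge0.
  case E : (k j - k i1) => [n|//] _.
  exists (laurent_t ^+ n * ps_laurent u); last first.
    by rewrite exprnP -E mulrA -expfzDr // addrC subrK.
  by exists (ps_of_poly 'X ^+ n * u); rewrite // /ps_laurent tofracM tofracXn.
exists (k i1); split=> [//||]; first by move=> m'; apply: bound.
rewrite /val_t asboolF => [|/(_ i0)/eqP]; last by rewrite (negPf wi0).
congr ((_%:~R)%:E); apply: xget_unique => [|m [mlat mmax]].
  by split=> // m'; apply: bound.
by apply/le_anti; rewrite bound //= mmax.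
Qed.

End Laurent.
(** * Tensor products *)

Section Tensor.
Variables (K : fieldType) (d : nat) (V : 'I_d -> vectType K).

(* V_1 (x) ... (x) V_d, through coordinates on the tensors e_J of the reference
   bases [vbasis {: V i}]; [tensor_universal] is the universal property. *)
Definition mindex : finType := {dffun forall i, 'I_(\dim {: V i})}.
Definition tensor : lmodType K := {ffun mindex -> K^o}.
(* K((t)) (x) V *)
Definition tensorL := {ffun mindex -> laurent K}.

Definition pure_tensor (x : forall i, V i) : tensor :=
  [ffun J : mindex => \prod_i coord (vbasis {: V i}) (J i) (x i)].

Definition tensor_base (v : tensor) : tensorL :=
  [ffun J => laurent_const (v J : K)].

Definition multilinear (W : lmodType K) (f : (forall i, V i) -> W) : Prop :=
  forall (x : forall i, V i) (i : 'I_d) (a : K) (y z : V i),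
    f (dfwith x (a *: y + z)) = a *: f (dfwith x y) + f (dfwith x z).

Let e_ (J : mindex) : forall i, V i := fun i => (vbasis {: V i})`_(J i).

Let coord_e i (k j : 'I_(\dim {: V i})) :
  coord (vbasis {: V i}) j (vbasis {: V i})`_k = (k == j)%:R.
Proof. by rewrite coord_free // (basis_free (vbasisP _)). Qed.

Let pure_e J : pure_tensor (e_ J) = [ffun I => (J == I)%:R].
Proof.
apply/ffunP => I; rewrite !ffunE.
under eq_bigr do rewrite coord_e.
have [<-|JI] := eqVneq J I; first by rewrite big1 // => i _; rewrite eqxx.
have [i Ji] : exists i, J i != I i.
  apply/existsP; rewrite -negb_forall; apply: contra JI => /forallP h.
  by apply/eqP/ffunP => i; apply/eqP.
by rewrite (bigD1 i) //= (negPf Ji) mul0r.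
Qed.

Let tensor_sum (v : tensor) : v = \sum_J (v J : K) *: pure_tensor (e_ J).
Proof.
apply/ffunP => I; rewrite sum_ffunE (bigD1 I) //= big1 ?addr0 => [|J JI].
  by rewrite pure_e !ffunE eqxx [LHS](esym (mulr1 _)).
by rewrite pure_e !ffunE (negPf JI) scaler0.
Qed.

Lemma pure_tensor_multilinear : multilinear pure_tensor.
Proof.
move=> x i a y z; apply/ffunP => J; rewrite !ffunE.
rewrite !(bigD1 i (P := predT)) //= !dfwith_in linearP mulrDl.
congr (_ + _); last first.
  by congr (_ * _); apply: eq_bigr => j; rewrite eq_sym => ij; rewrite !dfwith_out.
rewrite -mulrA; congr (_ * (_ * _)).
by apply: eq_bigr => j; rewrite eq_sym => ij; rewrite !dfwith_out.
Qed.

Let multilinear_ext (W : lmodType K) (f g : (forall i, V i) -> W) :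
  multilinear f -> multilinear g -> (forall J, f (e_ J) = g (e_ J)) ->
  forall x, f x = g x.
Proof.
move=> fl gl fg x.
pose bad x := [pred i : 'I_d | x i \notin vbasis {: V i}].
have [n] := ubnP #|bad x|; elim: n x => // n IH x; rewrite ltnS => le_n.
have [i badi|good] := pickP (bad x); last first.
  have k_ i : {k : 'I_(\dim {: V i}) | x i = (vbasis {: V i})`_k}.
    have /negbFE/tnthP/cid[k ->] := good i.
    by exists k; rewrite (tnth_nth 0).
  suff -> : x = e_ [ffun i => sval (k_ i)] by [].
  by apply: functional_extensionality_dep => i; rewrite /e_ ffunE; case: (k_ i).
have xE y : y = x i -> x = dfwith x y.
  move=> ->; apply: functional_extensionality_dep => j.
  by case: dfwithP.
rewrite (xE _ (esym (coord_vbasis (memvf _)))).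
suff h (r : seq 'I_(\dim {: V i})) (c : 'I_(\dim {: V i}) -> K) :
    f (dfwith x (\sum_(k <- r) c k *: (vbasis {: V i})`_k)) =
    g (dfwith x (\sum_(k <- r) c k *: (vbasis {: V i})`_k)) by apply: h.
elim: r => [|k r IHr].
  have z0 (h : (forall i, V i) -> W) : multilinear h -> h (dfwith x (0 : V i)) = 0.
    move=> hl; have := hl x i (-1) 0 0.
    by rewrite scaler0 addr0 scaleN1r addNr.
  by rewrite !big_nil !z0.
rewrite !big_cons fl gl IHr; congr (_ *: _ + _); apply: IH.
apply: leq_trans le_n; apply: proper_card; apply/properP; split.
  apply/fintype.subsetP => j; rewrite !inE; case: dfwithP => //.
by exists i => //; rewrite !inE dfwith_in mem_nth ?size_tuple.
Qed.

Lemma tensor_universal (W : lmodType K) (f : (forall i, V i) -> W) :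
  multilinear f ->
  exists F : {linear tensor -> W}, (forall x, F (pure_tensor x) = f x) /\
    forall F' : {linear tensor -> W},
      (forall x, F' (pure_tensor x) = f x) -> F' =1 F.
Proof.
move=> fl; pose F0 (v : tensor) := \sum_J (v J : K) *: f (e_ J).
have F0l : linear F0.
  move=> a u v; rewrite /F0 scaler_sumr -big_split /=; apply: eq_bigr => J _.
  by rewrite !ffunE scalerDl scalerA.
pose F : {linear tensor -> W} := HB.pack F0 (GRing.isLinear.Build _ _ _ _ F0 F0l).
have Fe J : F (pure_tensor (e_ J)) = f (e_ J).
  rewrite /F /= /F0 (bigD1 J) //= pure_e ffunE eqxx scale1r big1 ?addr0 // => I.
  by rewrite ffunE eq_sym => /negPf->; rewrite scale0r.
have FP x : F (pure_tensor x) = f x.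
  apply: (multilinear_ext (f := F \o pure_tensor)) x => // x i a y z.
  by rewrite /comp pure_tensor_multilinear linearP.
exists F; split=> // F' F'P v.
rewrite [v]tensor_sum !linear_sum; apply: eq_bigr => J _.
by rewrite !linearZ F'P -FP.
Qed.

(** * The group G *)

(* K((t)) (x) End(V_i) is the space of matrices over K((t)), which act on columns
   of coordinates in the basis [vbasis {: V i}]. *)
Definition endoL : Type := forall i, 'M[laurent K]_(\dim {: V i}).

Definition GL_of (R : set (laurent K)) (n : nat) : set 'M[laurent K]_n :=
  [set g : 'M_n | (forall i j, R (g i j)) /\ g \in unitmx].

Definition G_of (R : set (laurent K)) : set endoL :=
  [set g | forall i, GL_of R (g i)].

(* The operator g_1 (x) ... (x) g_d, see [act_pure]. *)
Definition act (g : endoL) (w : tensorL) : tensorL :=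
  [ffun J : mindex => \sum_(I : mindex) (\prod_i g i (J i) (I i)) * w I].

Lemma act_pure (g : endoL) (x : forall i, 'cV[laurent K]_(\dim {: V i})) :
  act g [ffun J : mindex => \prod_i x i (J i) 0] =
  [ffun J : mindex => \prod_i (g i *m x i) (J i) 0].
Proof.
apply/ffunP => J; rewrite !ffunE.
under [RHS]eq_bigr do rewrite mxE.
pose P i : {ffun 'I_(\dim {: V i}) -> laurent K} :=
  [ffun k => g i (J i) k * x i k 0].
have := @big_fprod (laurent K) 0 1 *%R +%R _ _ P.
rewrite -(bigA_distr_big_dep _ (fun i => untag 0 (P i))).
rewrite (reindex (@fprod_of_dffun _ _)); last exact/onW_bij/fprod_of_dffun_bij.
move=> e; transitivity (\sum_(I : mindex) \prod_i P i (fprod_of_dffun I i)).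
  apply: eq_bigr => I _; rewrite [X in _ * X]ffunE -big_split.
  apply: eq_bigr => i _.
  by rewrite /= ffunE fprodE.
rewrite e; apply: eq_bigr => i _.
transitivity (\sum_k P i k); first exact: (esym (big_tag (fun i => P i : _ -> _) i)).
by apply: eq_bigr => k _; rewrite ffunE.
Qed.

(* Columns: coordinates of the vectors b_j in [vbasis {: W}]. *)
Definition basis_mx (W : vectType K) (b : (\dim {: W}).-tuple W) :
  'M[laurent K]_(\dim {: W}) :=
  \matrix_(k, j) laurent_const (coord (vbasis {: W}) k b`_j).

Definition mx_in_basis (W : vectType K) (b : (\dim {: W}).-tuple W)
    (g : 'M[laurent K]_(\dim {: W})) : 'M[laurent K]_(\dim {: W}) :=
  invmx (basis_mx b) *m g *m basis_mx b.

Definition one_param_subgroup : set endoL :=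
  [set lam | G_of (@Kt K) lam /\
    forall i, exists b : (\dim {: V i}).-tuple (V i),
      [/\ basis_of {: V i} b,
          is_diag_mx (mx_in_basis b (lam i)) &
          forall j, exists x : nat,
            mx_in_basis b (lam i) j j = laurent_t K ^+ x]].

(** * The G-stable rank *)

Variables (R : realType) (alpha : 'I_d -> R).

(* [+oo^-1 = 0] in [\bar R]. *)
Definition mu (g : endoL) (v : tensor) : \bar R :=
  ((\sum_i (alpha i)%:E * val_t1 R (\det (g i))) /
     val_t R (act g (tensor_base v)))%E.

Definition rkG (v : tensor) : \bar R :=
  ereal_inf [set mu g v | g in
    [set g | G_of (@Ktt K) g /\ (0 < val_t R (act g (tensor_base v)))%E]].

End Tensor.

(* Main.v *)
From HB Require Import structures.
Require Import Defs.
From mathcomp Require Import all_boot all_order perm all_algebra all_field.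
From mathcomp Require Import boolp classical_sets reals ereal constructive_ereal.
Import Order.TTheory GRing.Theory Num.Theory.
Local Open Scope classical_set_scope.
Local Open Scope ring_scope.

Set Implicit Arguments.
Unset Strict Implicit.
Unset Printing Implicit Defensive.

(** Every [1]-parameter subgroup has entries in [K[[t]]], so the rank is at most
the second infimum. For the converse, each [g] in [G(K[[t]])] is replaced by a
[1]-parameter subgroup [lam] whose quotient [mu] is no larger ([degeneration]).

By the Smith normal form over the discrete valuation ring [K[[t]]], each factor
is [g_i = L_i D_i U_i], where [L_i], [U_i] are invertible over [K[[t]]] and [D_i]
is diagonal with powers of [t] on the diagonal ([smith_Ktt]). The factor [L]
preserves the lattices [t^m (K[[t]] (x) V)], hence changes no valuation, so only
[D U v] matters. Its coordinate at a multi-index [J] is [t^(x_J)] times the power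
series [(U v)_J], where [x_J] is a sum of exponents of [D]. If it is divisible by
[t^m], then either [x_J >= m] or [t] divides [(U v)_J], that is, [(U(0) v)_J = 0].
In both cases [t^m] divides [t^(x_J) (U(0) v)_J] ([tpow_lattice_eval0]). So
replacing [U] by its constant term [c = U(0)], an element of [GL(V_i)] in each
factor, does not decrease the valuation; multiplying by [c^-1] on the left does
not change it, and [lam = c^-1 D c] is a [1]-parameter subgroup, diagonal in the
basis formed by the columns of [c^-1] ([one_param_conj]).

The determinants of [g_i] and [lam_i] both are the determinant of [D_i] up to a
unit of [K[[t]]], so the numerators of [mu] agree, and they are nonnegative. *)

(** * Smith normal form over the power series *)

Section SmithForm.
Variable K : fieldType.
Implicit Types (p u : pseries K).

Definition psX : pseries K := ps_of_poly 'X.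

Definition ps_shift k p : pseries K := PSeries (fun n => ps_coef p (k + n)).

Lemma ps_shiftK k p :
  (forall i, (i < k)%N -> ps_coef p i = 0) -> p = psX ^+ k * ps_shift k p.
Proof.
elim: k p => [|k IH] p low.
  by rewrite mul1r; apply/psP.
rewrite exprS -mulrA; apply/psP => n; rewrite ps_coefXM.
case: n => [|n]; first exact: low.
have -> : ps_shift k.+1 p = ps_shift k (PSeries (fun n => ps_coef p n.+1)).
  by apply/psP => m.
by rewrite -IH // => i ik; apply: low.
Qed.

Definition smith n (A : 'M[pseries K]_n) :=
  exists L U : 'M[pseries K]_n, exists x : 'I_n -> nat,
  [/\ L \in unitmx, U \in unitmx &
      A = L *m diag_mx (\row_i psX ^+ x i) *m U].

Lemma smith_unit n (L U A B : 'M[pseries K]_n) :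
  L \in unitmx -> U \in unitmx -> A = L *m B *m U -> smith B -> smith A.
Proof.
move=> Lu Uu -> [L' [U' [x [L'u U'u ->]]]].
exists (L *m L'), (U' *m U), x; rewrite !unitmx_mul Lu Uu L'u U'u.
by split=> //; rewrite !mulmxA.
Qed.

Lemma smith_scale n (A : 'M[pseries K]_n) k :
  smith A -> smith (psX ^+ k *: A).
Proof.
move=> [L [U [x [Lu Uu ->]]]]; exists L, U, (fun i => (k + x i)%N).
split=> //; rewrite scalemxAl scalemxAr -linearZ; congr (_ *m diag_mx _ *m _).
by apply/rowP => i; rewrite !mxE exprD.
Qed.

Lemma smith_block n u (A : 'M[pseries K]_n) :
  u \is a GRing.unit -> smith A ->
  smith (block_mx u%:M 0 0 A : 'M_(1 + n)).
Proof.
move=> uu [L [U [x [Lu Uu ->]]]].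
exists (block_mx u%:M 0 0 L), (block_mx 1%:M 0 0 U),
  (fun i => if split i is inr j then x j else 0%N).
rewrite !unitmxE in Lu Uu *; split.
- by rewrite det_ublock det_scalar1 unitrM uu.
- by rewrite det_ublock det1 mul1r.
have -> : \row_i psX ^+ (if split i is inr j then x j else 0) =
    row_mx 1%:M (\row_j psX ^+ x j) :> 'rV_(1 + n).
  apply/rowP => i; rewrite !mxE; case: (split i) => j; rewrite !mxE //.
  by rewrite ord1 eqxx.
rewrite diag_mx_row !mulmx_block !(mul0mx, mulmx0, addr0, add0r).
suff -> : diag_mx 1%:M = 1%:M :> 'M[pseries K]_1 by rewrite !mulmx1.
by apply/matrixP => i j; rewrite !mxE !ord1.
Qed.

(** Block elimination with a unit pivot; the last diagonal block is the Schur
complement. *)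
Lemma pivot_factor n (A : 'M[pseries K]_(1 + n)) :
  ulsubmx A 0 0 \is a GRing.unit ->
  exists L U : 'M_(1 + n),
    [/\ \det L = 1, \det U = 1 & A = L *m block_mx (ulsubmx A 0 0)%:M 0 0
      (drsubmx A - dlsubmx A *m (ulsubmx A 0 0)^-1%:M *m ursubmx A) *m U].
Proof.
set u := ulsubmx A 0 0 => uu.
exists (block_mx 1%:M 0 (dlsubmx A *m u^-1%:M) 1%:M).
exists (block_mx 1%:M (u^-1%:M *m ursubmx A) 0 1%:M).
split; first by rewrite det_lblock !det1 mulr1.
  by rewrite det_ublock !det1 mulr1.
rewrite !mulmx_block !(mul0mx, mulmx0, addr0, add0r, mul1mx, mulmx1).
have uV : u^-1%:M *m u%:M = 1%:M :> 'M_1 by rewrite -scalar_mxM mulVr.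
have Vu : u%:M *m u^-1%:M = 1%:M :> 'M_1 by rewrite -scalar_mxM mulrV.
rewrite -{1}[A]submxK (mx11_scalar (ulsubmx A)) -/u; congr block_mx.
- by rewrite mulmxA Vu mul1mx.
- by rewrite -mulmxA uV mulmx1.
- by rewrite -[_ *m u%:M]mulmxA uV mulmx1 -!mulmxA addrC subrK.
Qed.

(** If [k] is the least order of an entry, then [A = t^k B] with [B] integral, and an
entry of order [k] becomes a unit of [B]. One elimination with this pivot thus
clears its row and its column, with no Euclidean descent. *)
Lemma smith_normal_form n (A : 'M[pseries K]_n) : \det A != 0 -> smith A.
Proof.
elim: n A => [|n IH] A detA.
  by exists 1%:M, 1%:M, (fun=> 0%N); rewrite unitmx1; split=> //; apply/matrixP => -[].
(* A is nonzero, so some entry has a nonzero coefficient. *)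
have ex : exists k, [exists i, exists j, ps_coef (A i j) k != 0].
  apply: contrapT => /forallNP none; case/eqP: detA.
  rewrite (expand_det_row _ 0) big1 // => j _.
  suff -> : A 0 j = 0 by rewrite mul0r.
  apply/psP => k; apply/eqP/negPn/negP => Ak; apply: (none k).
  by apply/existsP; exists 0; apply/existsP; exists j.
case: (ex_minnP ex) => k /existsP[i0 /existsP[j0 k0]] kmin {ex}.
have AE : A = psX ^+ k *: map_mx (ps_shift k) A.
  apply/matrixP => i j; rewrite !mxE; apply: ps_shiftK => l lk.
  apply/eqP/negPn/negP => Al; move: lk; rewrite ltnNge kmin //.
  by apply/existsP; exists i; apply/existsP; exists j.
set B := map_mx _ A in AE.
rewrite AE; apply: smith_scale.
have detB : \det B != 0.
  by apply: contra detA => /eqP dB; rewrite AE detZ dB mulr0.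
pose C : 'M_(1 + n) := xrow i0 0 (xcol j0 0 B).
have CE : B = tperm_mx i0 0 *m C *m tperm_mx j0 0.
  rewrite /C xrowE xcolE !mulmxA -perm_mxM tperm2 perm_mx1 mul1mx.
  by rewrite -!mulmxA -perm_mxM tperm2 perm_mx1 mulmx1.
apply: (smith_unit _ _ CE); rewrite ?unitmx_perm //.
have C00 : ulsubmx C 0 0 \is a GRing.unit.
  apply: ps_unitE; rewrite !mxE.
  rewrite (_ : lshift n 0 = 0); last exact/val_inj.
  by rewrite !tpermR /= addn0.
have [L [U [L1 U1 CLU]]] := pivot_factor C00.
apply: (smith_unit _ _ CLU); rewrite ?unitmxE ?L1 ?U1 ?unitr1 //.
apply: smith_block => //; apply: IH; apply: contra detB => /eqP d0.
have detC : \det C = 0 by rewrite CLU !det_mulmx det_ublock d0 !(mulr0, mul0r).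
by rewrite CE !det_mulmx detC mulr0 mul0r.
Qed.

End SmithForm.

(** * Morphisms between the rings of series and polynomials *)

Section Morphisms.
Variable K : fieldType.

Definition ps_eval0 (p : pseries K) : K := ps_coef p 0.

Fact ps_of_poly_is_zmod : zmod_morphism (@ps_of_poly K).
Proof. by move=> P Q; apply/psP => n; rewrite /= coefB. Qed.
Fact ps_of_poly_is_monoid : monoid_morphism (@ps_of_poly K).
Proof. by split=> // P Q; apply/psP => n; rewrite /= coefM. Qed.
HB.instance Definition _ :=
  GRing.isZmodMorphism.Build _ _ (@ps_of_poly K) ps_of_poly_is_zmod.
HB.instance Definition _ :=
  GRing.isMonoidMorphism.Build _ _ (@ps_of_poly K) ps_of_poly_is_monoid.

Fact ps_eval0_is_zmod : zmod_morphism ps_eval0.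
Proof. by []. Qed.
Fact ps_eval0_is_monoid : monoid_morphism ps_eval0.
Proof.
split=> [|p q]; first by rewrite /ps_eval0 /= coef1.
by rewrite /ps_eval0 [LHS]big_ord1.
Qed.
HB.instance Definition _ :=
  GRing.isZmodMorphism.Build _ _ ps_eval0 ps_eval0_is_zmod.
HB.instance Definition _ :=
  GRing.isMonoidMorphism.Build _ _ ps_eval0 ps_eval0_is_monoid.

HB.instance Definition _ := GRing.RMorphism.copy (@ps_laurent K)
  (@FracField.tofrac (pseries K)).
HB.instance Definition _ := GRing.RMorphism.copy (@laurent_const K)
  ((@ps_laurent K \o @ps_of_poly K) \o polyC).

Lemma ps_eval0_const (c : K) : ps_eval0 (ps_of_poly c%:P) = c.
Proof. by rewrite /ps_eval0 /= coefC. Qed.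

Lemma ps_laurent_inj : injective (@ps_laurent K).
Proof. by move=> p q /eqP; rewrite /ps_laurent tofrac_eq => /eqP. Qed.

End Morphisms.

(** * Valuations and lattices *)

Section Valuation.
Variables (K : fieldType) (R : realType) (I : finType).
Implicit Types w : I -> laurent K.

(** Comparing valuations through lattices avoids treating vectors of infinite
valuation apart: the zero vector is the one that lies in all lattices. *)
Lemma val_t_le w w' :
  (forall m, tpow_lattice m w -> tpow_lattice m w') ->
  (val_t R w <= val_t R w')%E.
Proof.
move=> sub; rewrite {2}/val_t; case: ifPn => [_|/asboolPn nz']; first exact: leey.
have [i' w'i'] : exists i, w' i != 0.
  apply: contrapT => h; apply: nz' => i.
  by apply/eqP/negPn/negP => wi; apply: h; exists i.
have [m' [lat' max' E']] := val_t_largest R (ex_intro _ i' w'i').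
(* Were w zero, it would lie in the lattice of index m' + 1, and so would w'. *)
have [i wi] : exists i, w i != 0.
  apply: contrapT => h.
  have /sub/max' : tpow_lattice (m' + 1) w.
    move=> i; exists 0; first by exists 0; rewrite ?rmorph0.
    by rewrite mulr0; apply/eqP/negPn/negP => wi; apply: h; exists i.
  by rewrite gerDl.
have [m [lat _ E]] := val_t_largest R (ex_intro _ i wi).
have := max' _ (sub _ lat); rewrite E.
by move: E'; rewrite /val_t asboolF // => -> ; rewrite lee_fin ler_int.
Qed.

Lemma val_t_ge0 w : (forall i, Ktt (w i)) -> (0 <= val_t R w)%E.
Proof.
move=> w0; have lat : tpow_lattice 0 w.
  by move=> i; exists (w i); rewrite // expr0z mul1r.
have [nz|h] := pselect (exists i, w i != 0); last first.
  rewrite /val_t asboolT // => i.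
  by apply/eqP/negPn/negP => wi; apply: h; exists i.
have [m [_ max ->]] := val_t_largest R nz.
by rewrite lee_fin ler0z; apply: max.
Qed.

End Valuation.

Section IntegralElements.
Variable K : fieldType.

Lemma KttM (x y : laurent K) : Ktt x -> Ktt y -> Ktt (x * y).
Proof. by move=> [p _ <-] [q _ <-]; exists (p * q); rewrite ?rmorphM. Qed.

Lemma KttD (x y : laurent K) : Ktt x -> Ktt y -> Ktt (x + y).
Proof. by move=> [p _ <-] [q _ <-]; exists (p + q); rewrite ?rmorphD. Qed.

Lemma Ktt_sum (J : finType) (F : J -> laurent K) :
  (forall j, Ktt (F j)) -> Ktt (\sum_j F j).
Proof.
move=> FK; elim/big_ind: _ => //; last exact: KttD.
by exists 0; rewrite ?rmorph0.
Qed.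

Lemma Ktt_prod (J : finType) (F : J -> laurent K) :
  (forall j, Ktt (F j)) -> Ktt (\prod_j F j).
Proof.
move=> FK; elim/big_ind: _ => //; last exact: KttM.
by exists 1; rewrite ?rmorph1.
Qed.

(** The key to the degeneration: if [t^x p] is divisible by [t^m] for a power series
[p], then either [m <= x], or [t] divides [p] and [p(0) = 0]. *)
Lemma tpow_lattice_eval0 (I : finType) (m : int) (x : I -> nat)
    (w : I -> pseries K) :
  tpow_lattice m (fun i => laurent_t K ^+ x i * ps_laurent (w i)) ->
  tpow_lattice m (fun i => laurent_t K ^+ x i * laurent_const (ps_eval0 (w i))).
Proof.
have t0 := laurent_t_neq0 K.
move=> lat i; have [mx|xm] := lerP m (x i)%:Z.
  have [n E] : exists n : nat, (x i)%:Z = m + n.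
    exists `|(x i)%:Z - m|%N.
    by rewrite gez0_abs ?subr_ge0 // subrKC.
  exists (ps_laurent (ps_of_poly 'X ^+ n * ps_of_poly (ps_eval0 (w i))%:P)).
    by exists (ps_of_poly 'X ^+ n * ps_of_poly (ps_eval0 (w i))%:P).
  by rewrite exprnP E expfzDr // -mulrA rmorphM rmorphXn.
have [_ [p _ <-]] := lat i.
have [n ->] : exists n : nat, m = (x i)%:Z + n.+1.
  exists `|m - (x i)%:Z|%N.-1; rewrite prednK ?absz_gt0 ?subr_eq0 ?gt_eqF //.
  by rewrite gtz0_abs ?subr_gt0 // subrKC.
rewrite expfzDr // -mulrA -exprnP => /(mulfI (expf_neq0 _ t0)).
rewrite -exprnP -rmorphXn -rmorphM => /ps_laurent_inj->.
exists 0; first by exists 0; rewrite ?rmorph0.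
by rewrite exprS -mulrA /ps_eval0 ps_coefXM rmorph0 !mulr0.
Qed.

End IntegralElements.

(** * The action on tensors *)

Section Action.
Variables (K : fieldType) (d : nat) (V : 'I_d -> vectType K).
Implicit Types (g h : endoL V) (w : tensorL V).

Lemma act_mul g h w : act (fun i => g i *m h i) w = act g (act h w).
Proof.
apply/ffunP => J; rewrite !ffunE.
under [RHS]eq_bigr do rewrite ffunE mulr_sumr.
rewrite exchange_big /=; apply: eq_bigr => I _.
have -> : \prod_i (g i *m h i) (J i) (I i) =
    \prod_i (g i *m col (I i) (h i)) (J i) 0.
  apply: eq_bigr => i _; rewrite !mxE.
  by apply: eq_bigr => k _; rewrite mxE.
have := act_pure g (fun i => col (I i) (h i)) => /ffunP/(_ J).
rewrite !ffunE => <-; rewrite mulr_suml; apply: eq_bigr => L _.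
by rewrite ffunE mulrA; congr (_ * _ * _); apply: eq_bigr => i _; rewrite mxE.
Qed.

Lemma act_lattice m g w : (forall i j k, Ktt (g i j k)) ->
  tpow_lattice m w -> tpow_lattice m (act g w).
Proof.
move=> gK lat J; have /choice[u uP] : forall I, exists u, Ktt u /\
    w I = laurent_t K ^ m * u by move=> I; have [u ? ?] := lat I; exists u.
exists (\sum_(I : mindex V) (\prod_i g i (J i) (I i)) * u I).
  apply: Ktt_sum => I; apply: KttM; last by case: (uP I).
  exact: Ktt_prod.
rewrite ffunE mulr_sumr; apply: eq_bigr => I _.
by rewrite (proj2 (uP I)) mulrCA.
Qed.

Lemma act_diag (x : forall i, 'I_(\dim {: V i}) -> nat) w (J : mindex V) :
  act (fun i => diag_mx (\row_j laurent_t K ^+ x i j)) w J =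
  laurent_t K ^+ (\sum_i x i (J i)) * w J.
Proof.
rewrite ffunE (bigD1 J) //= [X in _ + X]big1 ?addr0 => [|I IJ].
  rewrite expr_sum; congr (_ * _); apply: eq_bigr => i _.
  by rewrite !mxE eqxx.
have [i Ji] : exists i, J i != I i.
  apply/existsP; rewrite -negb_forall; apply: contra IJ => /forallP h.
  by apply/eqP/ffunP => i; apply/esym/eqP.
by rewrite (bigD1 i) //= !mxE (negPf Ji) !mul0r.
Qed.

(** Since [v] has constant coordinates, acting on it by [h(t)] commutes with setting
[t = 0]. *)
Lemma act_const (h : forall i, 'M[pseries K]_(\dim {: V i})) (v : tensor V) :
  exists w : mindex V -> pseries K,
    act (fun i => map_mx (@ps_laurent K) (h i)) (tensor_base v) =1
      (fun J => ps_laurent (w J)) /\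
    act (fun i => map_mx (@laurent_const K) (map_mx (@ps_eval0 K) (h i)))
      (tensor_base v) =1 (fun J => laurent_const (ps_eval0 (w J))).
Proof.
exists (fun J : mindex V => \sum_(I : mindex V) (\prod_i h i (J i) (I i)) * ps_of_poly (v I : K)%:P).
split=> J; rewrite ffunE !rmorph_sum; apply: eq_bigr => I _.
  rewrite ffunE rmorphM rmorph_prod; congr (_ * _).
  by apply: eq_bigr => i _; rewrite mxE.
rewrite ffunE !rmorphM; congr (_ * _).
  by rewrite !rmorph_prod; apply: eq_bigr => i _; rewrite !mxE.
exact: congr1 (esym (ps_eval0_const (v I : K))).
Qed.

End Action.

(** * Diagonal matrices in a constant basis *)

Section OneParameterSubgroups.
Variable K : fieldType.

Definition unitmx_tuple (W : vectType K) (P : 'M[K]_(\dim {: W})) :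
    (\dim {: W}).-tuple W :=
  [tuple \sum_k P k j *: (vbasis {: W})`_k | j < \dim {: W}].

Lemma unitmx_tuple_basis (W : vectType K) (P : 'M[K]_(\dim {: W})) :
  P \in unitmx -> basis_of {: W} (unitmx_tuple P).
Proof.
move=> Pu; rewrite basisEfree subvf size_tuple leqnn !andbT.
apply/freeP => a.
under eq_bigr do rewrite nth_mktuple scaler_sumr.
rewrite exchange_big /= => s0.
have {}s0 : \sum_k (P *m \col_j a j) k 0 *: (vbasis {: W})`_k = 0.
  rewrite -[RHS]s0; apply: eq_bigr => k _.
  rewrite mxE scaler_suml; apply: eq_bigr => j _.
  by rewrite mxE scalerA mulrC.
have /freeP/(_ _ s0) Pa := basis_free (vbasisP {: W}).
have /(canRL (mulKmx Pu)) : P *m \col_j a j = 0.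
  by apply/matrixP => k l; rewrite !ord1 Pa mxE.
by rewrite mulmx0 => /matrixP + j => /(_ j 0); rewrite !mxE.
Qed.

Lemma basis_mx_unitmx_tuple (W : vectType K) (P : 'M[K]_(\dim {: W})) :
  basis_mx (unitmx_tuple P) = map_mx (@laurent_const K) P.
Proof.
apply/matrixP => k j; rewrite !mxE nth_mktuple linear_sum (bigD1 k) //=.
rewrite linearZ /= coord_free ?(basis_free (vbasisP _)) // eqxx.
rewrite big1 ?addr0 ?mulr1 // => l lk.
by rewrite linearZ /= coord_free ?(basis_free (vbasisP _)) // (negPf lk) mulr0.
Qed.

(** Conjugating by a constant matrix keeps the entries polynomial; the basis in
which the result is diagonal consists of the columns of [c^-1]. *)
Lemma one_param_conj d (V : 'I_d -> vectType K)
    (c : forall i, 'M[K]_(\dim {: V i})) (x : forall i, 'I_(\dim {: V i}) -> nat) :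
  (forall i, c i \in unitmx) ->
  one_param_subgroup (fun i => map_mx (@laurent_const K) (invmx (c i)) *m
    (diag_mx (\row_j laurent_t K ^+ x i j) *m map_mx (@laurent_const K) (c i))).
Proof.
move=> cu; have cLu i : map_mx (@laurent_const K) (c i) \in unitmx.
  by rewrite map_unitmx.
split=> i.
  split=> [j k|].
    pose P := map_mx polyC (invmx (c i)) *m
      (diag_mx (\row_j 'X ^+ x i j) *m map_mx polyC (c i)).
    suff <- : map_mx (@ps_laurent K \o @ps_of_poly K) P =
        map_mx (@laurent_const K) (invmx (c i)) *m
        (diag_mx (\row_j laurent_t K ^+ x i j) *m
         map_mx (@laurent_const K) (c i)).
      by exists (P j k); rewrite ?mxE.
    rewrite /P !map_mxM map_diag_mx -!map_mx_comp.
    congr (_ *m (diag_mx _ *m _)).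
    by apply/rowP => l; rewrite !mxE rmorphXn.
  rewrite map_invmx !unitmx_mul unitmx_inv cLu andbT /= unitmxE det_diag.
  apply: rpred_prod => j _.
  by rewrite mxE unitrX // unitfE laurent_t_neq0.
have E : mx_in_basis (unitmx_tuple (invmx (c i)))
    (map_mx (@laurent_const K) (invmx (c i)) *m
    (diag_mx (\row_j laurent_t K ^+ x i j) *m map_mx (@laurent_const K) (c i)))
    = diag_mx (\row_j laurent_t K ^+ x i j).
  rewrite /mx_in_basis basis_mx_unitmx_tuple map_invmx invmxK.
  by rewrite mulKVmx // mulmxK.
exists (unitmx_tuple (invmx (c i))); rewrite E; split.
- by apply: unitmx_tuple_basis; rewrite unitmx_inv.
- exact: diag_mx_is_diag.
- by move=> j; exists (x i j); rewrite !mxE eqxx.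
Qed.

End OneParameterSubgroups.

(** * Degeneration to a 1-parameter subgroup *)

Section Degeneration.
Variable K : fieldType.

Lemma val_t1_unit (R : realType) (u : pseries K) (x : laurent K) :
  u \is a GRing.unit -> val_t1 R (ps_laurent u * x) = val_t1 R x.
Proof.
have scale (p : pseries K) y m : tpow_lattice m (fun _ : unit => y) ->
    tpow_lattice m (fun _ : unit => ps_laurent p * y).
  move=> lat i; have [q qK E] := lat tt.
  exists (ps_laurent p * q); first by apply: KttM => //; exists p.
  by rewrite [y]E mulrCA.
move=> uu; apply/le_anti/andP; split; apply: val_t_le => m; last exact: scale.
by move/(scale u^-1); rewrite mulrA -rmorphM mulVr // rmorph1 mul1r.
Qed.

(** A matrix over [K[[t]]] that is invertible over [K((t))] has nonzero determinant,
which is what the Smith normal form requires. *)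
Lemma smith_Ktt n (g : 'M[laurent K]_n) : GL_of (@Ktt K) g ->
  exists L U : 'M[pseries K]_n, exists x : 'I_n -> nat,
  [/\ L \in unitmx, U \in unitmx &
      g = map_mx (@ps_laurent K) L *m
        (diag_mx (\row_i laurent_t K ^+ x i) *m map_mx (@ps_laurent K) U)].
Proof.
move=> [gK gu].
have /choice[A_ gA] : forall ij, exists p, ps_laurent p = g ij.1 ij.2.
  by move=> ij; have [p _ <-] := gK ij.1 ij.2; exists p.
pose A := \matrix_(i, j) A_ (i, j).
have {gA} gE : g = map_mx (@ps_laurent K) A.
  by apply/matrixP => i j; rewrite !mxE gA.
have dA : \det A != 0.
  apply: contraTneq gu => dA.
  by rewrite unitmxE gE det_map_mx dA rmorph0 unitr0.
have [L [U [x [Lu Uu AE]]]] := smith_normal_form dA.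
exists L, U, x; split=> //; rewrite gE AE !map_mxM map_diag_mx mulmxA.
congr (_ *m diag_mx _ *m _).
by apply/rowP => i; rewrite !mxE rmorphXn.
Qed.

Variables (R : realType) (d : nat) (V : 'I_d -> vectType K).

(** For [g = L D U] as in the Smith normal form, [lam = c^-1 D c] with [c = U(0)]. The
inequality holds because [D U v] in [t^m (K[[t]] (x) V)] implies the same for
[D c v], while [L^-1] and [c^-1] preserve this lattice. *)
Lemma degeneration (g : endoL V) (v : tensor V) : G_of (@Ktt K) g ->
  exists lam : endoL V, [/\ one_param_subgroup lam,
    forall i, val_t1 R (\det (lam i)) = val_t1 R (\det (g i)) &
    (val_t R (act g (tensor_base v)) <= val_t R (act lam (tensor_base v)))%E].
Proof.
move=> gG; have S i := smith_Ktt (gG i).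
pose L i := sval (cid (S i)); pose U i := sval (cid (svalP (cid (S i)))).
pose x i := sval (cid (svalP (cid (svalP (cid (S i)))))).
have gE i : [/\ L i \in unitmx, U i \in unitmx &
    g i = map_mx (@ps_laurent K) (L i) *m
      (diag_mx (\row_j laurent_t K ^+ x i j) *m map_mx (@ps_laurent K) (U i))].
  exact: svalP (cid (svalP (cid (svalP (cid (S i)))))).
clearbody L U x => {S}.
pose c i := map_mx (@ps_eval0 K) (U i).
have cu i : c i \in unitmx.
  by have [_ Uu _] := gE i; rewrite unitmxE det_map_mx rmorph_unit -?unitmxE.
have cLu i : map_mx (@laurent_const K) (c i) \in unitmx by rewrite map_unitmx.
exists (fun i => map_mx (@laurent_const K) (invmx (c i)) *m
  (diag_mx (\row_j laurent_t K ^+ x i j) *m map_mx (@laurent_const K) (c i))).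
split; first exact: one_param_conj.
  move=> i; have [Lu Uu ->] := gE i; rewrite !det_mulmx.
  rewrite !(det_map_mx (@laurent_const K)) !(det_map_mx (@ps_laurent K)).
  rewrite !unitmxE in Lu Uu.
  rewrite [RHS](val_t1_unit R _ Lu) [in RHS]mulrC [RHS](val_t1_unit R _ Uu).
  rewrite mulrCA -(rmorphM (@laurent_const K)) -det_mulmx mulVmx // det1.
  by rewrite rmorph1 mulr1.
have gfun : g = fun i => map_mx (@ps_laurent K) (L i) *m
    (diag_mx (\row_j laurent_t K ^+ x i j) *m map_mx (@ps_laurent K) (U i)).
  by apply: functional_extensionality_dep => i; have [] := gE i.
apply: val_t_le => m lat.
have [w [wU wc]] := act_const U v.
(* Applying L^-1 turns g v into D U v. *)
have {}lat : tpow_lattice m (fun J : mindex V =>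
    laurent_t K ^+ (\sum_i x i (J i)) * ps_laurent (w J)).
  have := @act_lattice _ _ _ m (fun i => map_mx (@ps_laurent K) (invmx (L i))) _ _ lat.
  rewrite -act_mul => /(_ _) lat' J.
  have {lat'} [|u uK E] := lat' _ J.
    by move=> i j k; rewrite mxE; eexists.
  exists u; rewrite // -E -wU -act_diag -act_mul; congr (act _ _ _).
  apply: functional_extensionality_dep => i.
  have [Lu _ ->] := gE i.
  by rewrite mulmxA -map_mxM mulVmx // map_mx1 mul1mx.
rewrite act_mul; apply: act_lattice => [i j k|J].
  by rewrite mxE; eexists; last reflexivity.
have [u uK E] := tpow_lattice_eval0 lat J.
by exists u; rewrite // -E act_mul act_diag wc.
Qed.

End Degeneration.

Theorem theorem2p4 (R : realType) (K : fieldType) (perfK : perfect_field K)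
    (d : nat) (V : 'I_d -> vectType K) (v : tensor V)
    (alpha : 'I_d -> R) (alpha_gt0 : forall i, 0 < alpha i) :
  rkG alpha v =
  ereal_inf [set mu alpha lam v | lam in
    [set lam : endoL V | one_param_subgroup lam /\
       (0 < val_t R (act lam (tensor_base v)))%E]].
Proof.
apply/le_anti/andP; split.
  apply: ereal_inf_le_tmp => _ [lam [[lamKt lamB] pos] <-].
  exists lam => //; split=> // i; split=> [j k|]; last by case: (lamKt i).
  by have [/(_ j k)[p _ <-] _] := lamKt i; exists (ps_of_poly p).
apply: le_ereal_inf_tmp => _ [g [gG pos] <-].
have [lam [lam1 detE vle]] := degeneration R v gG.
apply: ge_ereal_inf; exists (mu alpha lam v).
  by exists lam => //; split=> //; apply: lt_le_trans vle.
rewrite /mu; under eq_bigr do rewrite detE.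
apply: lee_wpmul2l.
  apply: sume_ge0 => i _; apply: mule_ge0; first by rewrite lee_fin ltW.
  apply: val_t_ge0 => _; rewrite /determinant; apply: Ktt_sum => s.
  apply: KttM; last by apply: Ktt_prod => j; case: (gG i).
  by exists ((-1) ^+ s); rewrite // rmorph_sign.
rewrite lee_pV2 // inE ?ltW //.
exact: lt_le_trans vle.
Qed.
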